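(* Assume $\overline{\mathcal{G}}$ is compact with totally disconnected boundary $\partial\overline{\mathcal{G}}$. Then: - $\mathcal{A}$ is uniformly dense in the space of continuous real-valued functions on $\overline{\mathcal{G}}$; - the set of restrictions to $\partial\overline{\mathcal{G}}$ of functions in $\mathcal{A}$ is uniformly dense in the space of continuous real-valued functions on $\partial\overline{\mathcal{G}}$.
   Context: $\mathcal{G}$ is a connected, locally finite metric graph with countable vertex set and countable edge set. Each edge has a positive length and is identified with an interval. $\mathcal{G}$ carries the geodesic distance, and $\overline{\mathcal{G}}$ is its metric completion. A designated set of vertices, containing all vertices of degree $1$, forms the boundary vertices. $\mathcal{G}_{int}$ is $\mathcal{G}$ minus the boundary vertices, and $\partial\overline{\mathcal{G}}=\overline{\mathcal{G}}\setminus\mathcal{G}_{int}$. $\mathcal{A}$ is the set of functions $\phi:\overline{\mathcal{G}}\to\mathbb{R}$ such that: - $\phi$ is continuous on $\overline{\mathcal{G}}$; - $\phi$ is infinitely differentiable on the open edges of $\mathcal{G}$; - $\phi'=0$ in the complement of some finite collection of edges; - $\phi'=0$ in an open neighborhood of each vertex of $\mathcal{G}$. *)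

(* Defs.v *)
From HB Require Import structures.
From mathcomp Require Import all_boot all_order all_algebra.
From mathcomp Require Import all_classical all_reals all_analysis.
Set Implicit Arguments. Unset Strict Implicit. Unset Printing Implicit Defensive.
Import Order.TTheory GRing.Theory Num.Theory.
Import numFieldNormedType.Exports.
Local Open Scope classical_set_scope.
Local Open Scope ring_scope.

(* A combinatorial-metric graph: countable vertex and edge sets, each edge e
   has a tail [src e], a head [tgt e] and a length [len e] (loops and
   multiple edges are allowed).  Edge e is identified with [0, len e],
   0 corresponding to [src e] and [len e] to [tgt e]. *)
Record mgraph (R : realType) := MGraph {
  gV : countType;
  gE : countType;
  src : gE -> gV;
  tgt : gE -> gV;
  len : gE -> R }.

Section MetricGraph.
Variables (R : realType) (G : mgraph R).

Definition incident (v : gV G) (e : gE G) : Prop := src e = v \/ tgt e = v.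

Definition positive_lengths : Prop := forall e : gE G, 0 < len e.

Definition locally_finite : Prop :=
  forall v : gV G, finite_set [set e | incident v e].

Fixpoint walk (u v : gV G) (s : seq (gE G * bool)) : Prop :=
  match s with
  | [::] => u = v
  | (e, b) :: s' =>
      if b then src e = u /\ walk (tgt e) v s'
           else tgt e = u /\ walk (src e) v s'
  end.

Definition walk_length (s : seq (gE G * bool)) : R :=
  \sum_(eb <- s) len eb.1.

Definition connected_graph : Prop :=
  forall u v : gV G, exists s, walk u v s.

Definition degree_one (v : gV G) : Prop :=
  exists e, [/\ incident v e, src e <> tgt e &
                forall f, incident v f -> f = e].

Inductive gpoint := GV of gV G | GE of gE G & R.

Definition gvalid (p : gpoint) : Prop :=
  match p with GV _ => True | GE e t => 0 < t < len e end.

Definition edgept (e : gE G) (t : R) : gpoint :=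
  if t <= 0 then GV (src e) else if len e <= t then GV (tgt e) else GE e t.

Definition vdist (u v : gV G) : R :=
  inf [set walk_length s | s in [set s | walk u v s]].

(* the vertices through which one can leave a point, with the cost *)
Definition exits (p : gpoint) : seq (gV G * R) :=
  match p with
  | GV v => [:: (v, 0)]
  | GE e t => [:: (src e, t); (tgt e, len e - t)]
  end.

Definition gdist (p q : gpoint) : R :=
  inf ([set d | exists a c, [/\ a \in exits p, c \in exits q &
                     d = a.2 + vdist a.1 c.1 + c.2]]
       `|` [set d | exists e t s, [/\ p = GE e t, q = GE e s & d = `|t - s|]]).

Definition interior_point (B : set (gV G)) (p : gpoint) : Prop :=
  match p with GV v => ~ B v | GE _ _ => True end.

Definition is_completion (Gbar : completePseudoMetricType R)
  (iota : gpoint -> Gbar) : Prop :=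
  [/\ hausdorff_space Gbar,
      (forall p q, gvalid p -> gvalid q ->
         forall r : R, ball (iota p) r (iota q) <-> gdist p q < r) &
      closure (iota @` [set p | gvalid p]) = setT].

Definition bdry (Gbar : completePseudoMetricType R) (iota : gpoint -> Gbar)
  (B : set (gV G)) : set Gbar :=
  [set x | ~ exists p, [/\ gvalid p, interior_point B p & iota p = x]].

Definition on_edge (Gbar : completePseudoMetricType R) (iota : gpoint -> Gbar)
  (phi : Gbar -> R) (e : gE G) : R -> R :=
  fun t => phi (iota (edgept e t)).

Definition in_A (Gbar : completePseudoMetricType R) (iota : gpoint -> Gbar)
  (phi : Gbar -> R) : Prop :=
  [/\ continuous phi,
      (forall e (n : nat) t, 0 < t < len e ->
         derivable (derive1n n (on_edge iota phi e)) t 1),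
      (exists S : set (gE G), finite_set S /\
         forall e, ~ S e -> forall t, 0 < t < len e ->
           derive1 (on_edge iota phi e) t = 0) &
      (forall v : gV G, exists2 delta : R, 0 < delta &
         forall e t, 0 < t < len e -> gdist (GV v) (GE e t) < delta ->
           derive1 (on_edge iota phi e) t = 0)].

End MetricGraph.

(* Main.v *)
Require Import Defs.
From HB Require Import structures.
From mathcomp Require Import all_boot all_order all_algebra.
From mathcomp Require Import all_classical all_reals all_analysis.
From mathcomp Require Import ring lra.
Import Order.TTheory GRing.Theory Num.Theory.
Import numFieldNormedType.Exports.
Local Open Scope classical_set_scope.
Local Open Scope ring_scope.

(* Let S_m be the set of the edges of code < m.  Distinct connected components of
   the graph minus S_m are at positive distance, since joining them takes an edge
   of S_m.  Compactness and total disconnectedness of the boundary give an m such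
   that a continuous f oscillates little on each component; replace f by a
   constant on each of them, and on the edges of S_m by smooth steps following
   f.  The resulting function is Lipschitz for the geodesic distance,
   so it extends to the completion.  The boundary being closed, Tietze's theorem
   reduces the second density to the first. *)

(** * Smooth transition functions *)

(** A component need not have small diameter, so uniform continuity of [f] alone says nothing about
    its oscillation there. Total disconnectedness enters because nested components of successive
    tails shrink to a connected part of the boundary, hence to a point. Passing through Lipschitz
    functions avoids any analysis at boundary points: only finitely many edges carry a nonconstant
    function, so one Lipschitz constant serves the whole graph. The price is that, on each of these
    edges, a smooth function must follow [f] while being constant near both ends, with end values
    imposed by the neighbouring components; this is the purpose of the smooth staircases. A common
    plateau width then gives a vanishing derivative near every vertex. *)

Lemma is_derive_quadratic {R : realType} (f : R -> R) (C : R) :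
  f 0 = 0 -> (forall h, `|h| <= 1 -> `|f h| <= C * h ^+ 2) ->
  is_derive (0 : R) (1 : R) f 0.
Proof.
move=> f0 fC.
have C0 : 0 <= C.
  have := fC 1; rewrite normr1 lexx expr1n mulr1 => /(_ isT).
  exact: le_trans.
have H : (fun h => h^-1 *: (f (h *: (1 : R) + 0) - f 0)) @ (0 : R)^' --> (0 : R).
  apply/cvgr0Pnorm_lt => e e0; near=> h.
  have h0 : h != 0 by near: h; exact: nbhs_dnbhs_neq.
  have hs : `|h| < Num.min 1 (e / (C + 1)).
    near: h; apply: dnbhs0_lt; rewrite lt_min ltr01 divr_gt0//; lra.
  move: hs; rewrite lt_min => /andP[h1].
  rewrite ltr_pdivlMr; last lra.
  move=> he; rewrite f0 subr0 addr0 /GRing.scale/= mulr1 normrM normfV.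
  rewrite mulrC ltr_pdivrMr ?normr_gt0//.
  have hp : 0 < `|h| by rewrite normr_gt0.
  apply: (le_lt_trans (fC h (ltW h1))).
  rewrite -real_normK ?num_real// expr2 mulrA ltr_pM2r//.
  apply: le_lt_trans he; nra.
split; first by apply/cvg_ex; exists 0; exact: H.
exact/cvg_lim.
Unshelve. all: by end_near. Qed.

(** Read at [x = 1/h], the factor [x ^+ 2] turns this into [flat P h = O(h^2)] to the right of 0,
    whence a zero derivative at 0. The constant comes from [x^(n+2) / (n+2)! <= expR x]. *)
Lemma poly_le_expR {R : realType} (P : {poly R}) :
  exists C, forall x : R, 1 <= x -> `|P.[x]| * x ^+ 2 <= C * expR x.
Proof.
suff [C [n H]] : exists C n, forall x : R, 1 <= x -> `|P.[x]| <= C * x ^+ n.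
  exists (C * (n.+2)`!%:R) => x x1.
  have x0 : 0 <= x by lra.
  have C0 : 0 <= C.
    have := H 1 (lexx _); rewrite expr1n mulr1; exact: le_trans.
  apply: (@le_trans _ _ (C * x ^+ n * x ^+ 2)).
    by rewrite ler_wpM2r ?H// exprn_ge0.
  rewrite -mulrA -exprD addn2 -mulrA ler_wpM2l// mulrC -ler_pdivrMr ?ltr0n ?fact_gt0//.
  apply: le_trans (expR_ge1Dxn n.+1 x0); lra.
elim/poly_ind: P => [|P c [C [n IH]]].
  by exists 0, 0%N => x _; rewrite horner0 normr0 mul0r.
exists (C + `|c|), n.+1 => x x1.
rewrite hornerMXaddC (le_trans (ler_normD _ _))// mulrDl lerD//.
  rewrite normrM (ger0_norm (_ : 0 <= x)); last lra.
  by rewrite exprSr mulrA ler_wpM2r ?IH//; lra.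
by rewrite ler_peMr// exprn_ege1.
Qed.

(* [flat 1] is the classical flat function exp(-1/t); the polynomial factors
   P(1/t) make the family stable under differentiation. *)
Definition flat {R : realType} (P : {poly R}) (t : R) : R :=
  if 0 < t then P.[t^-1] * expR (- t^-1) else 0.

Lemma flat_le0 {R : realType} (P : {poly R}) t : t <= 0 -> flat P t = 0.
Proof. by rewrite /flat leNgt => /negPf ->. Qed.

(** By the chain rule [P(1/t) exp(-1/t)] has derivative [t^-2 (P - P')(1/t) exp(-1/t)], and [t^-2]
    is ['X^2] evaluated at [1/t]. At 0, where the two formulas meet, quadratic decay replaces the
    chain rule. *)
Lemma is_derive_flat {R : realType} (P : {poly R}) (t : R) :
  is_derive t (1 : R) (flat P) (flat ('X^2 * (P - P^`())) t).
Proof.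
have [t0|t0|->] := ltgtP t 0.
- rewrite (flat_le0 _ _ (ltW t0)).
  apply: (near_eq_is_derive (f := cst 0)).
  near=> s; rewrite /= flat_le0//; near: s.
  by apply: filterS (lt_nbhsl t0) => y /= /ltW.
- rewrite /(flat _ t) t0.
  have tn0 : t != 0 by rewrite gt_eqF.
  have dV : is_derive t (1:R) (fun s : R => s^-1) (- t ^- 2).
    have := @is_deriveV R id t 1 1 tn0 (is_derive_id _ _).
    by rewrite /GRing.scale/= mulr1.
  have dP : is_derive t (1:R) (fun s : R => P.[s^-1]) (P^`().[t^-1] * (- t ^- 2)).
    exact: (@is_derive1_comp R (horner P) (fun s : R => s^-1)).
  have dN : is_derive t (1:R) (fun s : R => - s^-1) (t ^- 2).
    by have := is_deriveN dV; rewrite opprK.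
  have dE : is_derive t (1:R) (fun s : R => expR (- s^-1)) (expR (- t^-1) * t ^- 2).
    exact: (@is_derive1_comp R expR (fun s : R => - s^-1)).
  have := is_deriveM dP dE.
  rewrite /GRing.scale/= => d; apply: (@near_eq_is_derive _ _ _ _ _ _ _ _ _ (is_derive_eq d _)).
    near=> s; rewrite /= /flat.
    suff -> : 0 < s by [].
    by near: s; exact: lt_nbhsr.
  by rewrite hornerM hornerXn hornerD hornerN exprVn; ring.
- rewrite (flat_le0 _ _ (lexx _)).
  have [C HC] := poly_le_expR P.
  have C0 : 0 <= C.
    have := HC 1 (lexx _); rewrite expr1n mulr1 => /(le_trans (normr_ge0 _)).
    by rewrite pmulr_lge0 ?expR_gt0.
  apply: (is_derive_quadratic _ C); first exact: flat_le0.
  move=> h h1; rewrite /flat; case: ifPn => [h0|_]; last first.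
    by rewrite normr0 mulr_ge0// sqr_ge0.
  move: h1; rewrite gtr0_norm// => h1.
  have := HC h^-1; rewrite invf_ge1// => /(_ h1).
  rewrite exprVn ler_pdivrMr ?exprn_gt0// => H.
  rewrite normrM (gtr0_norm (expR_gt0 _)) expRN ler_pdivrMr ?expR_gt0//.
  apply: le_trans H _; lra.
Unshelve. all: by end_near. Qed.

(** A syntactic class closed under differentiation: derivability to all orders follows by plain
    induction, without formulas for higher derivatives of products and composites. *)
Inductive smooth_term {R : realType} : (R -> R) -> Prop :=
| smooth_cst a : smooth_term (fun=> a)
| smooth_id : smooth_term id
| smooth_flat P : smooth_term (flat P)
| smooth_add f g : smooth_term f -> smooth_term g -> smooth_term (fun t => f t + g t)
| smooth_mul f g : smooth_term f -> smooth_term g -> smooth_term (fun t => f t * g t)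
| smooth_comp f g : smooth_term f -> smooth_term g -> smooth_term (fun t => f (g t)).

Lemma smooth_term_is_derive {R : realType} (f : R -> R) : smooth_term f ->
  exists2 f', smooth_term f' & forall t, is_derive t (1 : R) f (f' t).
Proof.
elim=> {f} [a||P|f g sf [f' sf' df] sg [g' sg' dg]|f g sf [f' sf' df] sg [g' sg' dg]
            |f g sf [f' sf' df] sg [g' sg' dg]].
- by exists (fun=> 0); [exact: smooth_cst|move=> t; exact: is_derive_cst].
- by exists (fun=> 1); [exact: smooth_cst|move=> t; exact: is_derive_id].
- by exists (flat ('X^2 * (P - P^`()))); [exact: smooth_flat|exact: is_derive_flat].
- by exists (fun t => f' t + g' t); [exact: smooth_add|move=> t; exact: is_deriveD].
- exists (fun t => f t * g' t + g t * f' t).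
    by apply: smooth_add; exact: smooth_mul.
  by move=> t; exact: is_deriveM.
- exists (fun t => f' (g t) * g' t).
    by apply: smooth_mul => //; exact: (smooth_comp f' g).
  by move=> t; exact: is_derive1_comp.
Qed.

Lemma smooth_term_derivable {R : realType} (f : R -> R) n t : smooth_term f ->
  derivable (derive1n n f) t 1.
Proof.
move=> sf; have {sf} : smooth_term (derive1n n f).
  elim: n => [//|n /smooth_term_is_derive[g sg dg]].
  rewrite /derive1n iterS -/(derive1n n f).
  suff -> : derive1 (derive1n n f) = g by [].
  by apply/funext => s; rewrite derive1E; have [] := dg s.
by case/smooth_term_is_derive => g _ /(_ t)[].
Qed.

Lemma smooth_term_continuous {R : realType} (f : R -> R) :
  smooth_term f -> continuous f.
Proof.
move=> sf t; apply: differentiable_continuous; apply/derivable1_diffP.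
exact: (smooth_term_derivable f 0%N t).
Qed.

Lemma flat1_homo {R : realType} : {homo @flat R 1 : s t / s <= t}.
Proof.
move=> s t st; rewrite /flat; case: ifPn => s0; last first.
  by case: ifPn => // _; rewrite hornerC mul1r expR_ge0.
rewrite (lt_le_trans s0 st) !hornerC !mul1r ler_expR lerN2 lef_pV2//.
by rewrite posrE (lt_le_trans s0 st).
Qed.

Lemma flat1_gt0 {R : realType} (t : R) : 0 < t -> 0 < flat 1 t.
Proof. by move=> t0; rewrite /flat t0 hornerC mul1r expR_gt0. Qed.

Lemma smooth_term_lipschitz01 {R : realType} (f : R -> R) : smooth_term f ->
  exists2 L, 0 <= L & forall s t, 0 <= s <= 1 -> 0 <= t <= 1 ->
    `|f s - f t| <= L * `|s - t|.
Proof.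
move=> sf; have [f' sf' df] := smooth_term_is_derive f sf.
have cf' := smooth_term_continuous f' sf'.
have [M [M1 M2]] := @EVT_max R (fun x => `|f' x|) 0 1 ler01
  (continuous_subspaceT (fun x => continuous_comp (cf' x) (@norm_continuous _ _ _))).
exists `|f' M| => // s t.
wlog st : s t / s <= t.
  move=> H s01 t01; have [st|/ltW ts] := leP s t; first exact: H.
  by rewrite distrC (distrC s); exact: H.
move=> /andP[s0 s1] /andP[t0 t1].
have [|c + H] := @MVT_segment R f f' s t st (fun x _ => df x).
  exact/continuous_subspaceT/(smooth_term_continuous f sf).
rewrite in_itv/= => /andP[sc ct].
rewrite distrC (distrC s) H normrM ler_wpM2r//.
by apply: M2; rewrite in_itv/=; apply/andP; split; lra.
Qed.

Definition clamp01 {R : realType} (x : R) : R := Num.max 0 (Num.min x 1).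

Lemma clamp01_itv {R : realType} (x : R) : 0 <= clamp01 x <= 1.
Proof. by rewrite le_max lexx/= ge_max ler01 ge_min lexx orbT. Qed.

Lemma clamp01_lip {R : realType} (s t : R) : `|clamp01 s - clamp01 t| <= `|s - t|.
Proof.
wlog st : s t / s <= t.
  move=> H; have [|/ltW] := leP s t; first exact: H.
  by rewrite distrC (distrC s); exact: H.
rewrite (distrC s) (ger0_norm (_ : 0 <= t - s)) ?subr_ge0// distrC /clamp01.
have [t1|t1] := leP t 1; have [s1|s1] := leP s 1;
  rewrite ?(min_l t1) ?(min_l s1) ?(min_r (ltW t1)) ?(min_r (ltW s1));
  rewrite ?(max_r ler01) ?subrr ?normr0 ?subr_ge0//.
- have [t0|t0] := leP t 0; have [s0|s0] := leP s 0; rewrite ger0_norm; lra.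
- by lra.
- have [s0|s0] := leP s 0; rewrite ger0_norm; lra.
Qed.

(** Such an [f] factors through [clamp01], a 1-Lipschitz retraction onto the unit interval, so the
    bound obtained there is global. *)
Lemma smooth_term_lipschitz {R : realType} (f : R -> R) (a b : R) :
  smooth_term f -> (forall t, t <= 0 -> f t = a) -> (forall t, 1 <= t -> f t = b) ->
  exists2 L, 0 <= L & forall s t, `|f s - f t| <= L * `|s - t|.
Proof.
move=> sf fa fb; have [L L0 fL] := smooth_term_lipschitz01 f sf.
have f_clamp x : f x = f (clamp01 x).
  rewrite /clamp01; have [x0|x0] := leP x 0.
    by rewrite max_l ?ge_min ?x0// !fa.
  rewrite max_r ?le_min ?(ltW x0) ?ler01//.
  have [x1|x1] := leP x 1; first by rewrite ?min_l.
  by rewrite ?min_r ?(ltW x1)// !fb// ltW.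
exists L => // s t.
rewrite (f_clamp s) (f_clamp t) (le_trans (fL _ _ (clamp01_itv s) (clamp01_itv t)))//.
by rewrite ler_wpM2l// clamp01_lip.
Qed.

(** [smooth_term] has no quotient, so nested [flat]s stand in for the usual
    [p(t) / (p(t) + p(1 - t))]. The change of variable [3 * t - 1] leaves a plateau of width 1/3 at
    each end of the unit interval. *)
Lemma smooth_step {R : realType} : exists (f : R -> R) (L : R),
  [/\ smooth_term f, forall t, t <= 3^-1 -> f t = 0,
      forall t, 2 / 3 <= t -> f t = 1, forall t, 0 <= f t <= 1 &
      0 <= L /\ forall s t, `|f s - f t| <= L * `|s - t|].
Proof.
pose a : R := flat 1 1.
have a0 : 0 < a by exact: flat1_gt0.
have b0 : 0 < flat 1 a by exact: flat1_gt0.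
(* [flat 1 (a - flat 1 t)] is constant for [t <= 0] and vanishes for [1 <= t]. *)
pose u (t : R) : R := a + (-1) * flat 1 (3 * t + -1).
pose f (t : R) := 1 + (- (flat 1 a)^-1) * flat 1 (u t); exists f.
have sf : smooth_term f.
  apply: smooth_add; first exact: smooth_cst.
  apply: smooth_mul; first exact: smooth_cst.
  apply: (smooth_comp (flat 1) u); first exact: smooth_flat.
  apply: smooth_add; first exact: smooth_cst.
  apply: smooth_mul; first exact: smooth_cst.
  apply: (smooth_comp (flat 1) (fun t => 3 * t + -1)); first exact: smooth_flat.
  apply: smooth_add; last exact: smooth_cst.
  apply: smooth_mul; first exact: smooth_cst.
  exact: smooth_id.
have f_0 t : t <= 3^-1 -> f t = 0.
  move=> t3; rewrite /f /u (flat_le0 _ (3 * t + -1)); last lra.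
  by rewrite mulr0 addr0 mulNr mulVf ?subrr// gt_eqF.
have f_1 t : 2 / 3 <= t -> f t = 1.
  move=> t3; rewrite /f (flat_le0 _ (u t)) ?mulr0 ?addr0//.
  have : flat 1 1 <= flat 1 (3 * t + -1) by apply: flat1_homo; lra.
  by rewrite /u -/a; lra.
have f01 t : 0 <= f t <= 1.
  have h0 s : 0 <= @flat R 1 s.
    have [s0|s0] := leP s 0; first by rewrite flat_le0.
    by rewrite ltW// flat1_gt0.
  rewrite /f mulNr; apply/andP; split.
    rewrite subr_ge0 mulrC ler_pdivrMr// mul1r; apply: flat1_homo.
    rewrite /u; have := h0 (3 * t + -1); lra.
  by rewrite gerBl mulr_ge0// invr_ge0 ltW.
have [|t t1|L L0 fL] := smooth_term_lipschitz f 0 1 sf.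
- by move=> t t0; apply: f_0; lra.
- by apply: f_1; lra.
by exists L.
Qed.

(** The jump from [v n] to [v n.+1] takes place in the middle third of the interval from [n d] to
    [(n+1) d], where the previous staircase has already settled at [v n]. The outer thirds stay
    flat, which gives the constancy at both ends. *)
Lemma smooth_staircase {R : realType} (F : R -> R) (d eta : R) (v : nat -> R) n :
  0 < d -> (forall s t, `|s - t| <= d -> `|F s - F t| <= eta) ->
  (forall i, `|v i - F (i%:R * d)| <= eta) ->
  exists h L, [/\ smooth_term h, forall t, t <= d / 3 -> h t = v 0%N,
    forall t, n%:R * d - d / 3 <= t -> h t = v n,
    0 <= L /\ forall s t, `|h s - h t| <= L * `|s - t| &
    forall t, 0 <= t <= n%:R * d -> `|h t - F t| <= 2 * eta].
Proof.
move=> d0 Fd vF; have [f [K [sf f_0 f_1 f01 [K0 fK]]]] := @smooth_step R.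
have eta0 : 0 <= eta by exact: le_trans (vF 0%N).
elim: n => [|n [h [L [sh h_0 h_n [L0 hL] hF]]]].
  exists (fun=> v 0%N), 0; split => //.
  - exact: smooth_cst.
  - by split => // s t; rewrite subrr normr0 mul0r.
  - move=> t t0; have -> : t = 0%:R * d by lra.
    by apply: (le_trans (vF 0%N)); lra.
have step t : d^-1 * t + - n%:R = (t - n%:R * d) / d by field; rewrite gt_eqF.
have f_le t : t <= n%:R * d + d / 3 -> f (d^-1 * t + - n%:R) = 0.
  by move=> td; rewrite step f_0// ler_pdivrMr//; lra.
exists (fun t => h t + (v n.+1 - v n) * f (d^-1 * t + - n%:R)),
  (L + `|v n.+1 - v n| * K / d).
have nd0 : 0 <= n%:R * d by rewrite mulr_ge0// ltW.
have nd1 : n.+1%:R * d = n%:R * d + d by rewrite -natr1 mulrDl mul1r.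
split.
- apply: smooth_add => //; apply: smooth_mul; first exact: smooth_cst.
  apply: (smooth_comp f (fun t => d^-1 * t + - n%:R)) => //.
  apply: smooth_add; last exact: smooth_cst.
  by apply: smooth_mul; [exact: smooth_cst|exact: smooth_id].
- move=> t td; rewrite h_0// f_le ?mulr0 ?addr0//; lra.
- move=> t; rewrite nd1 => td; rewrite h_n; last lra.
  by rewrite step f_1 ?ler_pdivlMr//; [ring|lra].
- split; first by rewrite addr_ge0// divr_ge0 ?mulr_ge0// ltW.
  move=> s t; rewrite opprD addrACA -mulrBr (le_trans (ler_normD _ _))// [leRHS]mulrDl lerD//.
  rewrite normrM -!mulrA ler_wpM2l// (le_trans (fK _ _))// ler_wpM2l//.
  have -> : d^-1 * s + - n%:R - (d^-1 * t + - n%:R) = d^-1 * (s - t) by ring.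
  by rewrite normrM gtr0_norm ?invr_gt0.
- move=> t /andP[t0]; rewrite nd1 => t1.
  have [tn|tn] := leP t (n%:R * d).
    by rewrite f_le ?mulr0 ?addr0 ?hF ?t0//; lra.
  rewrite h_n; last lra.
  have /andP[] := f01 (d^-1 * t + - n%:R).
  set q := f _ => q0 q1.
  have vn i : `|i%:R * d - t| <= d -> `|v i - F t| <= 2 * eta.
    move=> /Fd Fi; have := ler_normD (v i - F (i%:R * d)) (F (i%:R * d) - F t).
    rewrite addrA subrK => /le_trans; apply; have := vF i; lra.
  have v1 : `|v n - F t| <= 2 * eta by apply: vn; rewrite ler_norml; apply/andP; split; lra.
  have v2 : `|v n.+1 - F t| <= 2 * eta.
    by apply: vn; rewrite nd1 ler_norml; apply/andP; split; lra.
  (* A convex combination of two errors, each at most [2 * eta]: [eta] for the sampled value and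
     [eta] for the oscillation of [F] over a distance [d]. *)
  have -> : v n + (v n.+1 - v n) * q - F t =
    (1 - q) * (v n - F t) + q * (v n.+1 - F t) by ring.
  apply: (le_trans (ler_normD _ _)); rewrite !normrM (ger0_norm q0) (ger0_norm (_ : 0 <= 1 - q)); last lra.
  have -> : 2 * eta = (1 - q) * (2 * eta) + q * (2 * eta) by ring.
  by rewrite lerD// ler_wpM2l//; lra.
Qed.

(** A single [e] serves as plateau width and as inverse Lipschitz constant. Both kinds of condition
    persist when [e] decreases, so finitely many edges can share one by taking a minimum. *)
Lemma smooth_approx {R : realType} (F : R -> R) (l r eta a b : R) :
  0 < l -> 0 < r -> (forall s t, `|s - t| <= r -> `|F s - F t| <= eta) ->
  `|a - F 0| <= eta -> `|b - F l| <= eta ->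
  exists h, smooth_term h /\ exists e, [/\ 0 < e, forall t, t <= e -> h t = a,
    forall t, l - e <= t -> h t = b,
    forall s t, e * `|h s - h t| <= `|s - t| &
    forall t, 0 <= t <= l -> `|h t - F t| <= 2 * eta].
Proof.
move=> l0 r0 Fr aF bF; pose N := (Num.truncn (l / r)).+1.
pose d := l / N%:R; have N0 : 0 < N%:R :> R by rewrite ltr0n.
have d0 : 0 < d by rewrite divr_gt0.
have Nd : N%:R * d = l by rewrite mulrC divfK// gt_eqF.
have dr : d <= r.
  rewrite ler_pdivrMr// mulrC -ler_pdivrMr// ltW// /N.
  exact: truncnS_gt.
(* [N] is a successor, so the indices 0 and [N] differ and both end values can be imposed; the inner
   treads sample [F] exactly. *)
pose v i := if i == 0%N then a else if i == N then b else F (i%:R * d).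
have eta0 : 0 <= eta by exact: le_trans aF.
have [|i|h [L [sh h0 hN [L0 hL] hF]]] := @smooth_staircase R F d eta v N d0.
- by move=> s t st; apply: Fr; lra.
- rewrite /v; have [->|_] := eqVneq i 0%N; first by rewrite mul0r.
  by have [->|_] := eqVneq i N; rewrite ?Nd// subrr normr0.
(* [L + 1] rather than [L], which may be 0. *)
exists h; split => //; exists (Num.min (d / 3) (L + 1)^-1).
have L1 : 0 < L + 1 by lra.
rewrite Nd in hN hF.
split => //.
- by rewrite lt_min invr_gt0 L1 divr_gt0.
- by move=> t; rewrite le_min => /andP[/h0].
- move=> t ht; rewrite hN /v ?eqxx//; apply: le_trans ht.
  by rewrite lerB// ge_min lexx.
- move=> s t; apply: (@le_trans _ _ ((L + 1)^-1 * `|h s - h t|)).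
    by rewrite ler_wpM2r// ge_min lexx orbT.
  rewrite mulrC ler_pdivrMr// mulrC (le_trans (hL s t))// ler_wpM2r//; lra.
Qed.

(** How finiteness of [S_m] is used: a minimum of radii, taken code by code. A code that [unpickle]
    rejects adds no constraint. *)
Lemma bounded_code_uniform {R : realType} {E : countType} (P : E -> R -> Prop) :
  (forall x r s, s <= r -> P x r -> P x s) -> (forall x, exists2 r, 0 < r & P x r) ->
  forall n, exists2 r, 0 < r & forall x, (pickle x < n)%N -> P x r.
Proof.
move=> mP exP; elim=> [|n [r r0 rP]]; first by exists 1.
case En : (unpickle n : option E) => [e'|]; last first.
  exists r => // e; rewrite ltnS leq_eqVlt => /orP[/eqP en|]; last exact: rP.
  by move: En; rewrite -en pickleK.
have [s s0 sP] := exP e'; exists (Num.min r s); first by rewrite lt_min r0.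
move=> e; rewrite ltnS leq_eqVlt => /orP[/eqP en|en].
  move: En; rewrite -en pickleK => -[->]; apply: mP sP.
  by rewrite ge_min lexx orbT.
by apply: mP (rP _ en); rewrite ge_min lexx.
Qed.

Lemma derive1_locally_cst {R : realType} (f : R -> R) (a : R) (A : set R) t :
  open A -> A t -> (forall s, A s -> f s = a) -> derive1 f t = 0.
Proof.
move=> oA At fA; rewrite derive1E -(derive_cst a t (1 : R)).
by apply: near_eq_derive; near=> s; rewrite fA//; near: s; exact: open_nbhs_nbhs.
Unshelve. all: by end_near. Qed.

(** * Geodesic distance and tails of the graph *)

Section GraphMetric.
Context {R : realType} {G : mgraph R}.
Hypotheses (len_gt0 : positive_lengths G) (G_connected : connected_graph G).
Implicit Types (u v w : gV G) (e : gE G) (p q : gpoint G).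

Lemma walk_length_ge0 (s : seq (gE G * bool)) : 0 <= walk_length s.
Proof. by apply: sumr_ge0 => i _; exact: ltW. Qed.

Lemma walk_cat u v w (s1 s2 : seq (gE G * bool)) :
  walk u v s1 -> walk v w s2 -> walk u w (s1 ++ s2).
Proof.
elim: s1 u => [|[e b] s1 IH] u /=; first by move=> ->.
by case: b => -[-> /IH h] /h.
Qed.

Lemma vdist_le u v s : walk u v s -> vdist u v <= walk_length s.
Proof.
move=> uv; apply: ge_inf; last by exists s.
by exists 0 => _ [s' _ <-]; exact: walk_length_ge0.
Qed.

Lemma vdist_ge0 u v : 0 <= vdist u v.
Proof.
apply: lb_le_inf; last by move=> _ [s _ <-]; exact: walk_length_ge0.
by have [s uv] := G_connected u v; exists (walk_length s), s.
Qed.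

(** Connectedness is essential: on an empty set of walks [inf] has a default value, from which no
    walk can be extracted. *)
Lemma vdist_lt u v r : vdist u v < r ->
  exists2 s, walk u v s & walk_length s < r.
Proof.
move=> /inf_lt[|_ [s uv <-] sr]; last by exists s.
by have [s uv] := G_connected u v; exists (walk_length s), s.
Qed.

Lemma vdistxx u : vdist u u = 0.
Proof.
apply/le_anti; rewrite vdist_ge0 andbT.
by have := @vdist_le u u [::] erefl; rewrite /walk_length big_nil.
Qed.

Lemma vdist_edge e : vdist (src e) (tgt e) <= len e /\ vdist (tgt e) (src e) <= len e.
Proof.
have len1 b : walk_length [:: (e, b)] = len e by rewrite /walk_length big_seq1.
split; first by rewrite -(len1 true); apply: vdist_le.
by rewrite -(len1 false); apply: vdist_le.
Qed.

Lemma exits_ge0 p a : gvalid p -> a \in exits p -> 0 <= a.2.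
Proof.
case: p => [v|e t] /=; first by rewrite inE => _ /eqP ->.
by move=> /andP[t0 t1]; rewrite !inE => /orP[]/eqP-> /=; lra.
Qed.

Lemma exits_neq0 p : exists a, a \in exits p.
Proof.
case: p => [v|e t]; first by exists (v, 0); rewrite inE.
by exists (src e, t); rewrite inE eqxx.
Qed.

Lemma gdist_lb p q x :
  (forall a c, a \in exits p -> c \in exits q -> x <= a.2 + vdist a.1 c.1 + c.2) ->
  (forall e t s, p = GE e t -> q = GE e s -> x <= `|t - s|) -> x <= gdist p q.
Proof.
move=> H1 H2; apply: lb_le_inf.
  have [a ap] := exits_neq0 p; have [c cq] := exits_neq0 q.
  by exists (a.2 + vdist a.1 c.1 + c.2); left; exists a, c.
move=> _ [[a [c [ap cq ->]]]|[e [t [s [ep eq ->]]]]]; first exact: H1.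
exact: (H2 e).
Qed.

Lemma gdist_lt p q x : gdist p q < x ->
  (exists a c, [/\ a \in exits p, c \in exits q & a.2 + vdist a.1 c.1 + c.2 < x]) \/
  (exists e t s, [/\ p = GE e t, q = GE e s & `|t - s| < x]).
Proof.
move=> /inf_lt[|_ [[a [c [ap cq ->]]]|[e [t [s [ep eq ->]]]]] h].
- have [a ap] := exits_neq0 p; have [c cq] := exits_neq0 q.
  by exists (a.2 + vdist a.1 c.1 + c.2); left; exists a, c.
- by left; exists a, c.
- by right; exists e, t, s.
Qed.

Lemma gdist_has_lbound p q : gvalid p -> gvalid q -> has_lbound
  ([set d | exists a c, [/\ a \in exits p, c \in exits q &
                     d = a.2 + vdist a.1 c.1 + c.2]]
       `|` [set d | exists e t s, [/\ p = GE e t, q = GE e s & d = `|t - s|]]).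
Proof.
move=> vp vq; exists 0 => _ [[a [c [ap cq ->]]]|[e [t [s [_ _ ->]]]]]//.
by rewrite !addr_ge0 ?vdist_ge0// (exits_ge0 _ _ _ ap, exits_ge0 _ _ _ cq).
Qed.

Lemma gdist_le_exits p q a c : gvalid p -> gvalid q ->
  a \in exits p -> c \in exits q -> gdist p q <= a.2 + vdist a.1 c.1 + c.2.
Proof.
move=> vp vq ap cq; apply: ge_inf; first exact: gdist_has_lbound.
by left; exists a, c.
Qed.

Lemma gdist_le_edge e t s : gvalid (GE e t) -> gvalid (GE e s) ->
  gdist (GE e t) (GE e s) <= `|t - s|.
Proof.
move=> vt vs; apply: ge_inf; first exact: gdist_has_lbound.
by right; exists e, t, s.
Qed.

Lemma vdist_le_gdist u v : vdist u v <= gdist (GV u) (GV v).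
Proof.
apply: gdist_lb => // a c; rewrite !inE => /eqP-> /eqP-> /=.
by rewrite add0r addr0.
Qed.

Lemma gdist_vertex_edge v e t r : 0 < t < len e -> gdist (GV v) (GE e t) < r ->
  (vdist v (src e) < r /\ t < r) \/ (vdist v (tgt e) < r /\ len e - t < r).
Proof.
move=> /andP[t0 t1] /gdist_lt[[a [c []]]|[? [? [? []//]]]].
rewrite !inE => /eqP-> /orP[]/eqP-> /=; rewrite add0r => H; [left|right];
  have := vdist_ge0 v (src e); have := vdist_ge0 v (tgt e); move: H; lra.
Qed.

(** Leaving the edge costs at least this minimum, so anything nearer is reached inside it. *)
Lemma gdist_inside_edge e t q : 0 < t < len e -> gvalid q ->
  gdist (GE e t) q < Num.min t (len e - t) -> exists s, q = GE e s.
Proof.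
move=> /andP[t0 t1] vq /gdist_lt[[a [c [ap cq]]]|[e' [t' [s [[-> _]] -> _]]]];
  last by exists s.
have := exits_ge0 q c vq cq; have := vdist_ge0 a.1 c.1.
by move: ap; rewrite !inE lt_min => /orP[]/eqP-> /=; lra.
Qed.

Lemma gvalid_edgept e t : gvalid (edgept e t).
Proof. by rewrite /edgept; case: (leP t 0) => // t0; case: leP => //= ->; rewrite t0. Qed.

Lemma edgept_src e t : t <= 0 -> edgept e t = GV (src e).
Proof. by rewrite /edgept => ->. Qed.

Lemma edgept_tgt e t : len e <= t -> edgept e t = GV (tgt e).
Proof. by rewrite /edgept => h; rewrite leNgt (lt_le_trans (len_gt0 e) h)/= h. Qed.

Lemma edgept_inside e t : 0 < t < len e -> edgept e t = GE e t.
Proof. by rewrite /edgept => /andP[t0 t1]; rewrite !leNgt t0 t1. Qed.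

Lemma edgeptP e t : [\/ t <= 0 /\ edgept e t = GV (src e),
  len e <= t /\ edgept e t = GV (tgt e) | 0 < t < len e /\ edgept e t = GE e t].
Proof.
have [t0|t0] := leP t 0; first by apply: Or31; rewrite edgept_src.
have [t1|t1] := leP (len e) t; first by apply: Or32; rewrite edgept_tgt.
by apply: Or33; rewrite edgept_inside ?t0.
Qed.

(** Since [edgept] clamps its parameter, each edge becomes a 1-Lipschitz curve on the whole line,
    free of side conditions. Except for two inner points, a suitable pair of exits gives the
    bound. *)
Lemma gdist_edgept e s t : gdist (edgept e s) (edgept e t) <= `|s - t|.
Proof.
have vs := gvalid_edgept e s; have vt := gvalid_edgept e t.
have ex (x y : gpoint G) a c : gvalid x -> gvalid y -> a \in exits x -> c \in exits y ->
    a.2 + vdist a.1 c.1 + c.2 <= `|s - t| -> gdist x y <= `|s - t|.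
  by move=> vx vy ax cy; exact: (le_trans (gdist_le_exits _ _ _ _ vx vy ax cy)).
have [st1 st2] := vdist_edge e.
have n1 := ler_norm (s - t); have := ler_norm (t - s).
rewrite distrC => n2; have n0 := normr_ge0 (s - t).
case: (edgeptP e s) vs => -[hs ->] vs; case: (edgeptP e t) vt => -[ht ->] vt.
- by apply: (ex _ _ (src e, 0) (src e, 0)); rewrite ?inE ?eqxx//= vdistxx; lra.
- by apply: (ex _ _ (src e, 0) (tgt e, 0)); rewrite ?inE ?eqxx//=; lra.
- by apply: (ex _ _ (src e, 0) (src e, t)); rewrite ?inE ?eqxx//= vdistxx; lra.
- by apply: (ex _ _ (tgt e, 0) (src e, 0)); rewrite ?inE ?eqxx//=; lra.
- by apply: (ex _ _ (tgt e, 0) (tgt e, 0)); rewrite ?inE ?eqxx//= vdistxx; lra.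
- by apply: (ex _ _ (tgt e, 0) (tgt e, len e - t)); rewrite ?inE ?eqxx ?orbT//= vdistxx; lra.
- by apply: (ex _ _ (src e, s) (src e, 0)); rewrite ?inE ?eqxx//= vdistxx; lra.
- by apply: (ex _ _ (tgt e, len e - s) (tgt e, 0)); rewrite ?inE ?eqxx ?orbT//= vdistxx; lra.
- exact: gdist_le_edge.
Qed.

(* Codes given by [pickle] stand for an exhaustion of the edge set by finite
   sets: the walks below avoid the finitely many edges of code [< m]. *)
Definition tail_conn (m : nat) u v := exists s : seq (gE G * bool),
  walk u v s /\ all (fun eb => (m <= pickle eb.1)%N) s.

Lemma tail_conn_refl m u : tail_conn m u u.
Proof. by exists [::]. Qed.

Lemma tail_conn_trans m u v w :
  tail_conn m u v -> tail_conn m v w -> tail_conn m u w.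
Proof.
move=> [s1 [w1 a1]] [s2 [w2 a2]]; exists (s1 ++ s2); split.
  exact: walk_cat w2.
by rewrite all_cat a1.
Qed.

Lemma tail_conn_edge m e : (m <= pickle e)%N ->
  tail_conn m (src e) (tgt e) /\ tail_conn m (tgt e) (src e).
Proof.
by move=> me; split; [exists [:: (e, true)]|exists [:: (e, false)]]; rewrite /= me.
Qed.

Lemma tail_conn_sym m u v : tail_conn m u v -> tail_conn m v u.
Proof.
case=> s; elim: s u => [|[e b] s IH] u /=.
  by move=> [-> _]; exact: tail_conn_refl.
move=> [w1 /andP[me aS]]; have [st ts] := tail_conn_edge m e me.
case: b w1 => -[<- w1].
  exact: (tail_conn_trans _ _ _ _ (IH _ (conj w1 aS)) ts).
exact: (tail_conn_trans _ _ _ _ (IH _ (conj w1 aS)) st).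
Qed.

Lemma tail_conn_le m n u v : (m <= n)%N -> tail_conn n u v -> tail_conn m u v.
Proof.
move=> mn [s [ws aS]]; exists s; split => //.
by apply: sub_all aS => x /=; exact: leq_trans.
Qed.

Lemma tail_conn_isolated m w u : (forall e, incident w e -> (pickle e < m)%N) ->
  tail_conn m w u -> u = w.
Proof.
move=> iso [[|[e b] s] /= [ws aS]]; first by [].
move/andP: aS => [me _]; case: b ws => -[ee _].
  by have := iso e (or_introl ee); rewrite ltnNge me.
by have := iso e (or_intror ee); rewrite ltnNge me.
Qed.

(** A lower bound for the gap between distinct components at level [m]: a walk shorter than every
    removed edge uses none of them. Codes rejected by [unpickle] count as length 1, which keeps the
    minimum positive. *)
Fixpoint sep (m : nat) : R :=
  if m is n.+1 then Num.min (sep n) (oapp (@len R G) 1 (unpickle n)) else 1.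

Lemma sep_gt0 m : 0 < sep m.
Proof.
elim: m => //= m IH; rewrite lt_min IH; case: unpickle => //= e.
Qed.

Lemma sep_le m n : (m <= n)%N -> sep n <= sep m.
Proof.
move=> /subnK <-; elim: (n - m)%N => // k IH.
by rewrite addSn /= (le_trans _ IH)// ge_min lexx.
Qed.

Lemma sep_le_len m e : (pickle e < m)%N -> sep m <= len e.
Proof.
move=> /sep_le /le_trans; apply.
by rewrite /= pickleK ge_min lexx orbT.
Qed.

Lemma vdist_lt_sep m u v : vdist u v < sep m -> tail_conn m u v.
Proof.
move=> /vdist_lt[s uv sm]; exists s; split => //.
elim: s {uv} sm => [//|[e b] s IH] /=; rewrite /walk_length big_cons /= => sm.
have s0 : 0 <= walk_length s by exact: walk_length_ge0.
have le0 : 0 < len e by exact: len_gt0.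
move: s0; rewrite /walk_length => s0.
apply/andP; split; last by apply: IH; rewrite /walk_length; lra.
rewrite leqNgt; apply/negP => /sep_le_len; lra.
Qed.

(** * Lipschitz functions glued from the edges *)

Definition glue (c : gV G -> R) (h : gE G -> R -> R) (p : gpoint G) : R :=
  match p with GV v => c v | GE e t => h e t end.

Section Lipschitz.
Variables (c : gV G -> R) (h : gE G -> R -> R) (r : R).
Hypotheses (r_gt0 : 0 < r).
Hypothesis h_src : forall e t, t <= 0 -> h e t = c (src e).
Hypothesis h_tgt : forall e t, len e <= t -> h e t = c (tgt e).
Hypothesis h_lip : forall e s t, r * `|h e s - h e t| <= `|s - t|.

Lemma glue_edgept e t : glue c h (edgept e t) = h e t.
Proof.
case: (edgeptP e t) => -[ht ->] //=; first by rewrite h_src.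
by rewrite h_tgt.
Qed.

Lemma glue_lip_walk u v s : walk u v s -> r * `|c u - c v| <= walk_length s.
Proof.
elim: s u => [|[e b] s IH] u /=.
  by move=> ->; rewrite subrr normr0 mulr0 walk_length_ge0.
have hl : r * `|c (src e) - c (tgt e)| <= len e.
  have := h_lip e 0 (len e); rewrite h_src// (h_tgt e (len e))//.
  by rewrite sub0r normrN (gtr0_norm (len_gt0 e)).
rewrite /walk_length big_cons /= -/(walk_length s).
case: b => -[<- /IH]; move=> h1.
  apply: le_trans (lerD hl h1); rewrite -mulrDr ler_wpM2l//; first exact: ltW.
  exact: ler_distD.
apply: le_trans (lerD hl h1); rewrite -mulrDr ler_wpM2l//; first exact: ltW.
by rewrite (distrC (c (src e))); exact: ler_distD.
Qed.

Lemma glue_lip_vdist u v : r * `|c u - c v| <= vdist u v.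
Proof.
apply: lb_le_inf; first by have [s uv] := G_connected u v; exists (walk_length s), s.
by move=> _ [s uv <-]; exact: glue_lip_walk.
Qed.

Lemma glue_lip_exits p a : gvalid p -> a \in exits p ->
  r * `|glue c h p - c a.1| <= a.2.
Proof.
case: p => [v|e t] /=; first by rewrite inE => _ /eqP->/=; rewrite subrr normr0 mulr0.
move=> /andP[t0 t1]; rewrite !inE => /orP[]/eqP->/=.
  by rewrite -(h_src e 0)//; apply: (le_trans (h_lip _ _ _)); rewrite subr0 gtr0_norm.
rewrite -(h_tgt e (len e))//; apply: (le_trans (h_lip _ _ _)).
by rewrite distrC gtr0_norm// subr_gt0.
Qed.

(** Every cost defining [gdist] either splits into exit, walk and entry or stays within one edge;
    the bound holds on each piece and adds up by the triangle inequality. *)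
Lemma glue_lip p q : gvalid p -> gvalid q ->
  r * `|glue c h p - glue c h q| <= gdist p q.
Proof.
move=> vp vq; apply: gdist_lb => [a d ap dq|e t s -> ->]; last exact: h_lip.
have h1 := glue_lip_exits _ _ vp ap; have h2 := glue_lip_exits _ _ vq dq.
have h3 := glue_lip_vdist a.1 d.1.
apply: le_trans (lerD (lerD h1 h3) h2).
rewrite -!mulrDr ler_wpM2l ?(ltW r_gt0)// (distrC (glue c h q)).
by rewrite (le_trans (ler_distD (c d.1) _ _))// lerD2r ler_distD.
Qed.

End Lipschitz.
End GraphMetric.

Arguments sep {R} G m.

(** * Compact pseudometric spaces *)

Section CompactPseudoMetric.
Context {R : realType} {T : pseudoMetricType R}.

Lemma closure_ballP (A : set T) x :
  closure A x <-> forall r : R, 0 < r -> exists2 y, A y & ball x r y.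
Proof.
split=> [clA r r0|H U /nbhs_ballP[r /= r0 rU]].
  by have [y [Ay xy]] := clA _ (nbhsx_ballx x r r0); exists y.
by have [y Ay xy] := H r r0; exists y; split => //; exact: rU.
Qed.

Hypothesis cptT : compact [set: T].

Lemma compact_seq_cluster (x : nat -> T) : exists z, forall (r : R) n, 0 < r ->
  exists2 m, (n <= m)%N & ball z r (x m).
Proof.
have [z [_ zc]] := cptT (x @ \oo) _ filterT.
exists z => r n r0.
have /zc : (x @ \oo) (x @` [set m | (n <= m)%N]).
  by exists n => // m /= nm; exists m.
move=> /(_ _ (nbhsx_ballx z r r0)) [_ [[m /= nm <-] zm]].
by exists m.
Qed.

(** Otherwise points of [K n] outside [U] would cluster at a point of the intersection, hence inside
    the open set [U]. *)
Lemma nested_closed_sub (K : nat -> set T) (U : set T) :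
  (forall n, closed (K n)) -> (forall m n, (m <= n)%N -> K n `<=` K m) ->
  open U -> \bigcap_n K n `<=` U -> exists n, K n `<=` U.
Proof.
move=> cK dK oU KU; apply: contrapT => /forallNP H.
have [n|x xP] := @choice _ _ (fun n y => K n y /\ ~ U y).
  by apply: contrapT => /forallNP h; apply: (H n) => y Ky; apply: contrapT => Uy; apply: (h y).
have [z zc] := compact_seq_cluster x.
have Uz : U z.
  apply: KU => n _; rewrite ((closure_id (K n)).1 (cK n)); apply/closure_ballP => r r0.
  have [m nm zm] := zc r n r0; exists (x m) => //.
  by apply: (dK _ _ nm); have [] := xP m.
have : nbhs z U by exact: open_nbhs_nbhs.
move=> /nbhs_ballP[r /= r0 rU].
have [m _ /rU] := zc r 0%N r0.
by have [] := xP m.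
Qed.

(** If the intersection split, normality would put its two closed pieces in disjoint open sets; by
    compactness some [K n] would lie in their union while meeting both, against its
    connectedness. *)
Lemma nested_connected (K : nat -> set T) : hausdorff_space T ->
  (forall n, closed (K n)) -> (forall m n, (m <= n)%N -> K n `<=` K m) ->
  (forall n, connected (K n)) -> connected (\bigcap_n K n).
Proof.
move=> hT cK dK conK; apply: contrapT => /connectedPn[E [E0 KE [s1 s2]]].
have cKI : closed (\bigcap_n K n) by exact: closed_bigI.
have subE b : E b `<=` \bigcap_n K n by rewrite KE; case: b; [right|left].
have dis : E false `&` E true = set0 by exact: separated_disjoint.
have clE b : closed (E b).
  move=> x clx.
  have Kx : (\bigcap_n K n) x.
    by rewrite ((closure_id _).1 cKI); exact: closureS (subE b) _ clx.
  move: Kx; rewrite KE => -[] Ex; case: b clx => // clx.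
    by have : (E false `&` closure (E true)) x by []; rewrite s2.
  by have : (closure (E false) `&` E true) x by []; rewrite s1.
have [U [V [oU oV EU EV UV]]] :
    exists U V, [/\ open U, open V, E false `<=` U, E true `<=` V & U `&` V = set0].
  by apply: (normal_openP (R := R)).1 => //; exact: compact_normal.
have [n KUV] : exists n, K n `<=` U `|` V.
  apply: nested_closed_sub => //; first exact: openU.
  by rewrite KE; apply: setUSS.
have [x Ex] := E0 false; have [y Ey] := E0 true.
have Kx := subE _ _ Ex n I; have Ky := subE _ _ Ey n I.
have sUV : separated U V.
  have sep0 (A B : set T) : open B -> A `&` B = set0 -> closure A `&` B = set0.
    move=> oB AB; rewrite -subset0 => z [clz Bz].
    have [t ABt] := clz B (open_nbhs_nbhs (conj oB Bz)).
    by move: ABt; rewrite AB.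
  by split; [|rewrite setIC]; apply: sep0 => //; rewrite setIC.
have [KU|KV] := connected_subset sUV KUV (conK n).
  suff : (U `&` V) y by rewrite UV.
  by split; [exact: KU|exact: EV].
suff : (U `&` V) x by rewrite UV.
by split; [exact: EU|exact: KV].
Qed.

Lemma compact_uniform (f : T -> R) (eta : R) : continuous f -> 0 < eta ->
  exists2 r : R, 0 < r & forall x y, ball x r y -> `|f x - f y| < eta.
Proof.
move=> cf e0; apply: contrapT => /forall2NP H.
have [n|x xP] := @choice _ _ (fun n (y : T * T) => ball y.1 n.+1%:R^-1 y.2 /\
    eta <= `|f y.1 - f y.2|).
  case: (H n.+1%:R^-1) => [|/existsNP[y /existsNP[z /not_implyP[yz]]]].
    by rewrite invr_gt0 ltr0n.
  by move/negP; rewrite -leNgt => h; exists (y, z).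
have [z zc] := compact_seq_cluster (fun n => (x n).1).
have /cvgrPdist_lt /(_ (eta / 2)) := cf z.
rewrite divr_gt0// => /(_ isT) /nbhs_ballP[r /= r0 rf].
have r20 : 0 < r / 2 by rewrite divr_gt0.
(* From this rank on [m.+1%:R^-1 <= r / 2], so both members of the pair lie in the ball of radius
   [r] around [z]. *)
have [m nm zm] := zc (r / 2) (Num.truncn (r / 2)^-1) r20.
have [xy] := xP m; apply/negP; rewrite -ltNge.
have h1 := rf _ (le_ball (_ : r / 2 <= r) zm).
have h2 : `|f z - f (x m).2| < eta / 2.
  apply: rf; rewrite [r]splitr; apply: ball_triangle zm _.
  apply: le_ball xy; rewrite invf_ple ?posrE//.
  apply/ltW/(lt_le_trans (truncnS_gt _)); rewrite ler_nat ltnS//.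
have := ler_distD (f z) (f (x m).1) (f (x m).2); rewrite (distrC _ (f z)).
have : `|f z - f (x m).1| < eta / 2 by apply: h1; lra.
lra.
Qed.

End CompactPseudoMetric.

(** * Oscillation on the tails *)

Section Completion.
Context {R : realType} {G : mgraph R} {Gbar : completePseudoMetricType R}.
Context {iota : gpoint G -> Gbar}.
Hypotheses (len_gt0 : positive_lengths G) (G_connected : connected_graph G).
Hypothesis iotaP : is_completion iota.
Implicit Types (u v w : gV G) (e : gE G) (p q : gpoint G).

Lemma ball_iota p q r : gvalid p -> gvalid q ->
  ball (iota p) r (iota q) <-> gdist p q < r.
Proof. by move=> vp vq; have [_ H _] := iotaP; exact: H. Qed.

Lemma dense_iota x (r : R) : 0 < r ->
  exists p, gvalid p /\ ball (iota p) r x.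
Proof.
move=> r0; have [_ _ d] := iotaP.
have : closure (iota @` [set p | gvalid p]) x by rewrite d.
move=> /closure_ballP/(_ r r0)[_ [p vp <-] xp].
by exists p; split=> //; exact: ball_sym.
Qed.

Lemma ball_edgept e s t r : `|s - t| < r ->
  ball (iota (edgept e s)) r (iota (edgept e t)).
Proof.
move=> st; apply/ball_iota; [exact: gvalid_edgept|exact: gvalid_edgept|].
exact: le_lt_trans (gdist_edgept len_gt0 G_connected e s t) st.
Qed.

Lemma continuous_edgept e : continuous (fun t : R => iota (edgept e t)).
Proof.
move=> t; apply/cvg_ballP => r r0; near=> s.
apply: ball_edgept; near: s.
by apply/nbhs_ballP; exists r => //= s; rewrite /ball/=.
Unshelve. all: by end_near. Qed.

(** The component of [u] once the open edges of code [< m] are removed, seen in the completion.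
    Testing [src e] is enough: a kept edge links its own ends. As [t] is clamped, the whole closed
    edge is included. *)
Definition tail_comp (m : nat) u : set Gbar :=
  [set x | (exists2 w, tail_conn m u w & x = iota (GV w)) \/
    exists e t, [/\ (m <= pickle e)%N, tail_conn m u (src e) & x = iota (edgept e t)]].

Lemma tail_comp_vertex m u w : tail_conn m u w -> tail_comp m u (iota (GV w)).
Proof. by move=> uw; left; exists w. Qed.

Lemma tail_comp_sub m n u v : (m <= n)%N -> tail_conn m u v ->
  tail_comp n v `<=` tail_comp m u.
Proof.
move=> mn uv x [[w vw ->]|[e [t [ne ve ->]]]]; [left|right].
  by exists w => //; exact: tail_conn_trans uv (tail_conn_le _ _ _ _ mn vw).
exists e, t; split => //; first exact: leq_trans ne.
exact: tail_conn_trans uv (tail_conn_le _ _ _ _ mn ve).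
Qed.

Lemma connected_edge_image e : connected ((fun t : R => iota (edgept e t)) @` `[0, len e]).
Proof.
apply: connected_continuous_connected; first exact: segment_connected.
exact/continuous_subspaceT/continuous_edgept.
Qed.

Lemma edgept_clamp e t : exists2 s, s \in `[0, len e] & edgept e t = edgept e s.
Proof.
have l0 := len_gt0 e.
case: (edgeptP len_gt0 e t) => -[ht ht'].
- by exists 0; rewrite ?in_itv/= ?lexx ?(ltW l0)// ht' edgept_src.
- by exists (len e); rewrite ?in_itv/= ?lexx ?(ltW l0)// ht' edgept_tgt.
- by exists t => //; rewrite in_itv/=; apply/andP; split; lra.
Qed.

Lemma connected_component_edge A e s t :
  (forall t, A (iota (edgept e t))) ->
  connected_component A (iota (edgept e s)) (iota (edgept e t)).
Proof.
move=> Ae; have [s' s'l ->] := edgept_clamp e s; have [t' t'l ->] := edgept_clamp e t.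
exists ((fun t : R => iota (edgept e t)) @` `[0, len e]); last by exists t'.
split; [by exists s'| |exact: connected_edge_image].
by move=> _ [x _ <-].
Qed.

(** Kept edges are continuous images of segments, and tail walks chain them from [u] to every
    point. *)
Lemma connected_tail_comp m u : connected (tail_comp m u).
Proof.
pose A := tail_comp m u.
have Ae e : (m <= pickle e)%N -> tail_conn m u (src e) -> forall t, A (iota (edgept e t)).
  by move=> me ue t; right; exists e, t.
have Av v : tail_conn m u v -> A (iota (GV v)) by exact: tail_comp_vertex.
have cce e : (m <= pickle e)%N -> tail_conn m u (src e) -> forall s t,
    connected_component A (iota (edgept e s)) (iota (edgept e t)).
  by move=> me ue s t; apply: connected_component_edge; exact: Ae.
have vert s v w : walk v w s -> all (fun eb => (m <= pickle eb.1)%N) s ->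
    tail_conn m u v -> connected_component A (iota (GV v)) (iota (GV w)).
  elim: s v => [|[e b] s IH] v /=.
    by move=> -> _ uw; apply: connected_component_refl; exact: Av.
  move=> vw /andP[me aS] uv; have [c1 c2] := tail_conn_edge m e me.
  case: b vw => -[ev vw]; rewrite -ev in uv *.
    apply: connected_component_trans (IH _ vw aS (tail_conn_trans _ _ _ _ uv c1)).
    by have := cce e me uv 0 (len e); rewrite (edgept_src e 0)// (edgept_tgt len_gt0 e (len e)).
  have ue := tail_conn_trans _ _ _ _ uv c2.
  apply: connected_component_trans (IH _ vw aS ue).
  by have := cce e me ue (len e) 0; rewrite (edgept_src e 0)// (edgept_tgt len_gt0 e (len e)).
suff -> : tail_comp m u = connected_component A (iota (GV u)) by exact: component_connected.
apply/seteqP; split; last exact: connected_component_sub.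
have vu v : tail_conn m u v -> connected_component A (iota (GV u)) (iota (GV v)).
  by move=> [s [ws aS]]; exact: vert ws aS (tail_conn_refl _ _).
move=> x [[v uv ->]|[e [t [me ue ->]]]]; first exact: vu.
apply: connected_component_trans (vu _ ue) _.
by have := cce e me ue 0 t; rewrite edgept_src.
Qed.

(** At such a level [w] is a component by itself and the others stay at distance at least [sep G m]
    from it, so a component adherent to [w] is that one. *)
Lemma closure_tail_comp_vertex m u w :
  (forall e, incident w e -> (pickle e < m)%N) ->
  closure (tail_comp m u) (iota (GV w)) -> tail_comp m u `<=` [set iota (GV w)].
Proof.
move=> iso /closure_ballP/(_ _ (sep_gt0 len_gt0 m))[y uy wy].
have iso' e : (m <= pickle e)%N -> ~ tail_conn m w (src e) /\ ~ tail_conn m w (tgt e).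
  move=> me; split=> /(tail_conn_isolated _ _ _ iso) ew.
    by have := iso e (or_introl ew); rewrite ltnNge me.
  by have := iso e (or_intror ew); rewrite ltnNge me.
have near_conn v : gdist (GV w) (GV v) < sep G m -> tail_conn m w v.
  by move=> wv; apply: vdist_lt_sep => //; apply: le_lt_trans wv; exact: vdist_le_gdist.
have {y uy wy} uw : tail_conn m u w.
  case: uy wy => [[v uv ->]|[e [t [me _ ->]]]].
    move=> /ball_iota -/(_ I I)/near_conn/(tail_conn_isolated _ _ _ iso) vw.
    by rewrite -vw.
  move=> /ball_iota -/(_ I (gvalid_edgept _ _)).
  case: (edgeptP len_gt0 e t) => -[ht ->].
  - by move=> /near_conn/(iso' e me).1.
  - by move=> /near_conn/(iso' e me).2.
  - move=> /(gdist_vertex_edge len_gt0 G_connected _ _ _ _ ht)[[h _]|[h _]];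
      have /= := vdist_lt_sep len_gt0 G_connected _ _ _ h.
      by move/(iso' e me).1.
    by move/(iso' e me).2.
have wu := tail_conn_sym _ _ _ uw.
move=> x [[v uv ->]|[e [t [me ue ->]]]].
  by rewrite (tail_conn_isolated _ _ _ iso (tail_conn_trans _ _ _ _ wu uv)).
by have := (iso' e me).1 (tail_conn_trans _ _ _ _ wu ue).
Qed.

(** Close to an inner point of [e] the only graph points are inner points of [e], and at level [m]
    these belong to no component. *)
Lemma closure_tail_comp_edge m u e t : 0 < t < len e -> (pickle e < m)%N ->
  ~ closure (tail_comp m u) (iota (GE e t)).
Proof.
move=> te em /closure_ballP/(_ (Num.min t (len e - t)))[|y].
  by rewrite lt_min subr_gt0.
move=> [[v _ ->]|[e' [s [me' _ ->]]]].
  by move=> /ball_iota -/(_ te I)/(gdist_inside_edge len_gt0 G_connected e t (GV v) te I)[].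
move=> /ball_iota -/(_ te (gvalid_edgept _ _)).
move=> /(gdist_inside_edge len_gt0 G_connected _ _ _ te (gvalid_edgept _ _))[s'].
case: (edgeptP len_gt0 e' s) => -[_ ->] // -[ee _].
by move: em; rewrite -ee ltnNge me'.
Qed.

Hypothesis G_locally_finite : locally_finite G.
Hypothesis cptG : compact [set: Gbar].

Lemma incident_bound w : exists m, forall e, incident w e -> (pickle e < m)%N.
Proof.
have /finite_seqP[F wF] := G_locally_finite w.
exists (\max_(e <- F) pickle e).+1 => e we.
have : [set` F] e by rewrite -wF.
by rewrite /= ltnS => eF; rewrite (big_rem e)//= leq_maxl.
Qed.

(* If every tail has a component of oscillation > eta, these components can be
   chosen nested around a cluster point z.  The intersection of their closures
   is connected, contains no vertex and no edge point, hence lies in the boundary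
   and reduces to z; by compactness the oscillation is then small, absurd. *)
Lemma tail_comp_small_osc (B : set (gV G)) (f : Gbar -> R) (eta : R) :
  totally_disconnected (bdry iota B) -> continuous f -> 0 < eta ->
  exists m, forall u x y, tail_comp m u x -> tail_comp m u y -> `|f x - f y| <= eta.
Proof.
move=> tdB cf eta0; apply: contrapT => /forallNP H.
pose bad m u := exists x y, [/\ tail_comp m u x, tail_comp m u y & eta < `|f x - f y|].
have [m|v vP] := @choice _ _ bad.
  have /existsNP[u /existsNP[x /existsNP[y /not_implyP[ux /not_implyP[uy /negP]]]]] := H m.
  by rewrite -ltNge => xy; exists u, x, y.
have [z zc] := compact_seq_cluster cptG (fun n => iota (GV (v n))).
have bad_le m n u w : (m <= n)%N -> tail_conn m u w -> bad n w -> bad m u.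
  move=> mn uw [x [y [wx wy xy]]]; exists x, y; split => //.
    exact: tail_comp_sub mn uw _ wx.
  exact: tail_comp_sub mn uw _ wy.
have near_conn m u w : ball z (sep G m / 2) (iota (GV u)) ->
    ball z (sep G m / 2) (iota (GV w)) -> tail_conn m u w.
  move=> zu zw; apply: vdist_lt_sep => //.
  apply: le_lt_trans (vdist_le_gdist _ _) _; apply/ball_iota => //.
  by rewrite [sep G m]splitr; apply: ball_triangle (ball_sym zu) zw.
have sep2 m : 0 < sep G m / 2 :> R by rewrite divr_gt0// sep_gt0.
(* A late [v n] close to [z] is bad at level [n], hence at level [m], since components grow when
   fewer edges are removed. Two vertices within [sep G m / 2] of [z] are joined at level [m], which
   nests the chosen components. *)
have [m|u uP] := @choice _ _ (fun m u => ball z (sep G m / 2) (iota (GV u)) /\ bad m u).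
  have [n mn zn] := zc _ m (sep2 m).
  by exists (v n); split => //; exact: bad_le mn (tail_conn_refl _ _) (vP n).
pose K i := closure (tail_comp i (u i)).
have K_le m n : (m <= n)%N -> K n `<=` K m.
  move=> mn; apply: closureS; apply: tail_comp_sub => //.
  apply: near_conn; first by have [] := uP m.
  apply: le_ball (uP n).1; by rewrite ler_pM2r// sep_le.
have cK n : closed (K n) by exact: closed_closure.
pose Q := \bigcap_n K n.
have Kz : Q z.
  move=> n _; apply/closure_ballP => r r0.
  have [|m nm zm] := zc (Num.min r (sep G n / 2)) n; first by rewrite lt_min r0 sep2.
  exists (iota (GV (v m))); last by apply: le_ball zm; rewrite ge_min lexx.
  apply/tail_comp_vertex/near_conn; first by have [] := uP n.
  by apply: le_ball zm; rewrite ge_min lexx orbT.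
have conQ : connected Q.
  apply: nested_connected => //; first by have [] := iotaP.
  by move=> n; apply: connected_closure; exact: connected_tail_comp.
have Qbdry : Q `<=` bdry iota B.
  move=> x Qx [[w|e t] [vp _ xE]]; subst x.
    (* Once all edges at [w] are removed, the component is the single point [w] and has zero
       oscillation, although [u m] is bad. *)
    have [m wm] := incident_bound w.
    have [_ [x [y [ux uy]]]] := uP m.
    have sub := closure_tail_comp_vertex _ _ _ wm (Qx m I).
    by rewrite (sub _ ux) (sub _ uy) subrr normr0 ltNge (ltW eta0).
  exact: (closure_tail_comp_edge _ _ _ _ vp (leqnn _) (Qx (pickle e).+1 I)).
have Q1 : Q `<=` [set z].
  rewrite -(tdB z (Qbdry _ Kz)); exact: connected_component_max.
have /cvgrPdist_lt /(_ (eta / 2)) := cf z.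
rewrite divr_gt0// => /(_ isT) /nbhs_ballP[r /= r0 rf].
have [n Kn] : exists n, K n `<=` (ball z r)°.
  apply: nested_closed_sub => //; first exact: open_interior.
  by move=> x /Q1 ->; apply: nbhsx_ballx.
have near_z x : tail_comp n (u n) x -> `|f z - f x| < eta / 2.
  by move=> /subset_closure/Kn/interior_subset/rf.
have [_ [x [y [/near_z ux /near_z uy]]]] := uP n.
have := ler_distD (f z) (f x) (f y); rewrite (distrC _ (f z)); lra.
Qed.

End Completion.

(** * Density *)

Section Approximation.
Context {R : realType} {G : mgraph R} {Gbar : completePseudoMetricType R}.
Context {iota : gpoint G -> Gbar}.
Hypotheses (len_gt0 : positive_lengths G) (G_connected : connected_graph G).
Hypothesis iotaP : is_completion iota.
Implicit Types (u v w : gV G) (e : gE G) (p q : gpoint G).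

(* McShane's extension formula, with radii of balls in place of distances. *)
Lemma lipschitz_extension (Phi : gpoint G -> R) (r : R) : 0 < r ->
  (forall p q, gvalid p -> gvalid q -> r * `|Phi p - Phi q| <= gdist p q) ->
  exists2 phi : Gbar -> R, continuous phi & forall p, gvalid p -> phi (iota p) = Phi p.
Proof.
move=> r0 PhiL.
have ballL p q s t x : gvalid p -> gvalid q -> ball (iota p) s x -> ball (iota q) t x ->
    `|Phi p - Phi q| <= s / r + t / r.
  move=> vp vq px qx; rewrite -mulrDl ler_pdivlMr// mulrC (le_trans (PhiL _ _ vp vq))// ltW//.
  by apply/(ball_iota iotaP) => //; exact: ball_triangle px (ball_sym qx).
(* This estimate alone yields both the extension property, by letting [s] tend to 0, and
   continuity. *)
have [x|phi phiP] := @choice _ _ (fun x y => forall p s, gvalid p ->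
    ball (iota p) s x -> `|Phi p - y| <= s / r).
  pose E := [set Phi p.1 + p.2 / r | p in [set p | gvalid p.1 /\ ball (iota p.1) p.2 x]].
  have lbE p s : gvalid p -> ball (iota p) s x -> lbound E (Phi p - s / r).
    move=> vp px _ [[q t] /= [vq qx] <-].
    have := ballL _ _ _ _ _ vp vq px qx; rewrite ler_norml; lra.
  have [p0 [vp0 p0x]] := dense_iota iotaP x 1 ltr01.
  exists (inf E) => p s vp px; rewrite ler_norml; apply/andP; split.
    suff : inf E <= Phi p + s / r by lra.
    by apply: ge_inf; [exists (Phi p0 - 1 / r); exact: lbE|exists (p, s)].
  suff : Phi p - s / r <= inf E by lra.
  apply: lb_le_inf; last exact: lbE.
  by exists (Phi p0 + 1 / r), (p0, 1).
exists phi; last first.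
  move=> p vp; apply/eqP; rewrite eq_sym -subr_eq0 -normr_le0; apply/ler_addgt0Pl => s s0.
  rewrite addr0; have := phiP (iota p) p (s * r) vp; rewrite mulfK ?gt_eqF//; apply.
  by apply: ballxx; rewrite mulr_gt0.
move=> x; apply/cvgrPdist_lt => s s0; apply/nbhs_ballP.
have d0 : 0 < s * r / 4 by rewrite divr_gt0// mulr_gt0.
(* The error is [s / 4] at [x] and [s / 4 + s / 4] at [y], in total less than [s]. *)
exists (s * r / 4) => //= y xy.
have [p [vp px]] := dense_iota iotaP x _ d0.
have h1 := phiP x p _ vp px; have h2 := phiP y p _ vp (ball_triangle px xy).
have e1 : s * r / 4 / r = s / 4 by field; rewrite gt_eqF.
rewrite mulrDl e1 in h2; rewrite e1 in h1.
have := ler_distD (Phi p) (phi x) (phi y); rewrite (distrC (phi x) (Phi p)); lra.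
Qed.

Hypothesis G_locally_finite : locally_finite G.
Hypothesis cptG : compact [set: Gbar].

Lemma dense_in_A (B : set (gV G)) (f : Gbar -> R) (eps : R) :
  totally_disconnected (bdry iota B) -> continuous f -> 0 < eps ->
  exists2 phi, in_A iota phi & forall x, `|f x - phi x| < eps.
Proof.
(* Error budget: [2 * eta] at graph points, then [eta] for [f] and [eta] for [phi] when moving to a
   nearby point of the completion. *)
move=> tdB cf eps0; pose eta := eps / 5.
have eta0 : 0 < eta by rewrite divr_gt0.
have [m mP] := tail_comp_small_osc len_gt0 G_connected iotaP G_locally_finite cptG
  B f eta tdB cf eta0.
have [r0 r00 fr0] := compact_uniform cptG f eta cf eta0.
(* A supremum depends on the component only, so no representative vertex has to be chosen. *)
pose c v := sup [set f (iota (GV w)) | w in tail_conn m v].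
have c_near v : `|c v - f (iota (GV v))| <= eta.
  have ubE : ubound [set f (iota (GV w)) | w in tail_conn m v] (f (iota (GV v)) + eta).
    move=> _ [w vw <-].
    have := mP v _ _ (tail_comp_vertex _ _ _ (tail_conn_refl m v)) (tail_comp_vertex _ _ _ vw).
    rewrite ler_norml; lra.
  have h1 : f (iota (GV v)) <= c v.
    apply: ub_le_sup; first by exists (f (iota (GV v)) + eta).
    by exists v => //; exact: tail_conn_refl.
  have h2 : c v <= f (iota (GV v)) + eta.
    apply: ge_sup => //; exists (f (iota (GV v))), v => //; exact: tail_conn_refl.
  by rewrite ler_norml; lra.
have c_conn u v : tail_conn m u v -> c u = c v.
  move=> uv; rewrite /c; congr (sup (_ @` _)); apply/funext => w; apply/propext; split.
    exact/tail_conn_trans/tail_conn_sym.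
  exact: tail_conn_trans.
pose P h e r := [/\ forall t, t <= r -> h t = c (src e),
  forall t, len e - r <= t -> h t = c (tgt e) &
  forall s t, r * `|h s - h t| <= `|s - t|].
have [e|h hP] := @choice _ _ (fun e h => [/\ smooth_term h,
    forall t, 0 <= t <= len e -> `|h t - f (iota (edgept e t))| <= 2 * eta,
    (m <= pickle e)%N -> h = fun=> c (src e) & exists2 r, 0 < r & P h e r]).
  (* An edge outside [S_m] lies with both ends in one component: the constant is within [eta] of [f]
     at [src e], and [f] varies by at most [eta] from there. *)
  have [me|me] := leqP m (pickle e).
    have csrc : c (src e) = c (tgt e) by apply: c_conn; have [] := tail_conn_edge _ _ me.
    exists (fun=> c (src e)); split => //; first exact: smooth_cst.
      move=> t _; have cs := c_near (src e).
      have fs : `|f (iota (GV (src e))) - f (iota (edgept e t))| <= eta.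
        apply: (mP (src e)); first exact/tail_comp_vertex/tail_conn_refl.
        by right; exists e, t; split => //; exact: tail_conn_refl.
      have := ler_distD (f (iota (GV (src e)))) (c (src e)) (f (iota (edgept e t))); lra.
    by exists 1 => //; split => // s t; rewrite subrr normr0 mulr0.
  (* Halving [r0] turns the non-strict inequality assumed on parameters into the strict one of
     balls. *)
  have [||||h [sh [r [r_gt0 hs ht hL hF]]]] :=
      @smooth_approx R (fun t => f (iota (edgept e t))) (len e) (r0 / 2) eta
        (c (src e)) (c (tgt e)) (len_gt0 e).
  - by rewrite divr_gt0.
  - move=> s t st; apply/ltW/fr0/(ball_edgept len_gt0 G_connected iotaP); lra.
  - by rewrite edgept_src.
  - by rewrite (edgept_tgt len_gt0).
  - by exists h; split => //; exists r.
have [r r_gt0 rP] : exists2 r, 0 < r & forall e, P (h e) e r.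
  have [|e|r r_gt0 rP] := @bounded_code_uniform R _ (fun e r => P (h e) e r) _ _ m.
  - move=> e r s sr [h1 h2 h3]; split => [t ts|t ts|t t'].
    + by apply: h1; lra.
    + by apply: h2; lra.
    + by apply: le_trans (h3 t t'); rewrite ler_wpM2r.
  - by have [] := hP e.
  exists r => // e; have [em|me] := ltnP (pickle e) m; first exact: rP.
  have csrc : c (src e) = c (tgt e) by apply: c_conn; have [] := tail_conn_edge _ _ me.
  have [_ _ -> // _] := hP e.
  by split => // s t; rewrite subrr normr0 mulr0.
have h_src e t : t <= 0 -> h e t = c (src e).
  by move=> t0; have [-> //] := rP e; rewrite (le_trans t0)// ltW.
have h_tgt e t : len e <= t -> h e t = c (tgt e).
  by move=> t0; have [_ -> //] := rP e; lra.
have h_lip e s t : r * `|h e s - h e t| <= `|s - t| by have [] := rP e.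
have [phi cphi phiE] := lipschitz_extension (glue c h) r r_gt0
  (glue_lip len_gt0 G_connected c h r r_gt0 h_src h_tgt h_lip).
have on_edgeE e : on_edge iota phi e = h e.
  apply/funext => t; rewrite /on_edge phiE; last exact: gvalid_edgept.
  exact: glue_edgept.
exists phi.
  split => //.
  - move=> e n t _; rewrite on_edgeE; apply: smooth_term_derivable.
    by have [] := hP e.
  - exists [set e | (pickle e < m)%N]; split.
      apply: (@finite_preimage _ _ `I_m pickle); last exact: finite_II.
      by move=> e e' _ _; exact: (pcan_inj pickleK).
    move=> e /negP; rewrite -leqNgt => me t _; rewrite on_edgeE.
    have [_ _ -> // _] := hP e.
    exact: derive1_cst.
  (* One radius serves all vertices: a point within [r] of any vertex is within [r] of an end of its
     own edge, hence on a plateau. *)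
  - move=> v; exists r => // e t te; rewrite on_edgeE.
    have [hs ht _] := rP e.
    move=> /(gdist_vertex_edge len_gt0 G_connected _ _ _ _ te)[[_ tr]|[_ tr]].
      apply: (derive1_locally_cst _ (c (src e)) [set s | s < r]).
      - exact: open_lt.
      - exact: tr.
      - by move=> s /= sr; apply: hs; exact: ltW.
    apply: (derive1_locally_cst _ (c (tgt e)) [set s | len e - r < s]).
    - exact: open_gt.
    - by rewrite /=; lra.
    - by move=> s /= sr; apply: ht; exact: ltW.
move=> x; have [r1 r10 phir1] := compact_uniform cptG phi eta cphi eta0.
have [|p [vp px]] := dense_iota iotaP x (Num.min r0 r1); first by rewrite lt_min r00.
have hf : `|f (iota p) - f x| < eta.
  by apply: fr0; apply: le_ball px; rewrite ge_min lexx.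
have hphi : `|phi (iota p) - phi x| < eta.
  by apply: phir1; apply: le_ball px; rewrite ge_min lexx orbT.
have hp : `|phi (iota p) - f (iota p)| <= 2 * eta.
  rewrite phiE//; case: p vp {px hf hphi} => [v|e t] /= vp.
    by apply: (le_trans (c_near v)); lra.
  have [_ + _ _] := hP e => /(_ t); rewrite edgept_inside//; apply.
  by apply/andP; split; lra.
move: hf hphi hp; rewrite !ltr_norml !ler_norml /eta; lra.
Qed.

End Approximation.

(** * Closedness of the boundary *)

Section Boundary.
Context {R : realType} {G : mgraph R} {Gbar : completePseudoMetricType R}.
Context {iota : gpoint G -> Gbar}.
Hypotheses (len_gt0 : positive_lengths G) (G_connected : connected_graph G).
Hypotheses (iotaP : is_completion iota) (G_locally_finite : locally_finite G).
Implicit Types (u v w : gV G) (e : gE G) (p q : gpoint G).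

(* The closed edges are compact, so no point is added by the completion near
   a point whose neighbors lie on finitely many edges. *)
Lemma iota_surj_near p (r : R) m : 0 < r -> gvalid p ->
  (forall q, gvalid q -> gdist p q < r ->
     q = p \/ exists e t, (pickle e < m)%N /\ q = edgept e t) ->
  forall x, ball (iota p) (r / 2) x -> exists2 q, gvalid q & iota q = x.
Proof.
move=> r0 vp near_p x px; have [hT _ _] := iotaP.
pose D := [set iota p] `|` \bigcup_(e in [set e | (pickle e < m)%N])
  (fun t : R => iota (edgept e t)) @` `[0, len e].
have clD : closed D.
  apply: closedU; first exact: (compact_closed hT (@compact_set1 _ _)).
  apply: closed_bigcup.
    apply: (@finite_preimage _ _ `I_m pickle); last exact: finite_II.
    by move=> e e' _ _; exact: (pcan_inj pickleK).
  move=> e _; apply: compact_closed => //; apply: continuous_compact.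
    exact/continuous_subspaceT/(continuous_edgept len_gt0 G_connected iotaP).
  exact: segment_compact.
have : D x.
  rewrite ((closure_id D).1 clD); apply/closure_ballP => s s0.
  have [|q [vq qx]] := dense_iota iotaP x (Num.min s (r / 2)).
    by rewrite lt_min s0 divr_gt0.
  exists (iota q); last by apply/ball_sym/(le_ball _ qx); rewrite ge_min lexx.
  have pq : gdist p q < r.
    apply/(ball_iota iotaP) => //; rewrite [r]splitr; apply: ball_triangle px _.
    by apply/ball_sym/(le_ball _ qx); rewrite ge_min lexx orbT.
  have [->|[e [t [em ->]]]] := near_p q vq pq; first by left.
  have [s' s'l ->] := edgept_clamp len_gt0 e t.
  by right; exists e => //; exists s'.
case=> [->|[e _ [t _ <-]]]; first by exists p.
by exists (edgept e t) => //; exact: gvalid_edgept.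
Qed.

(** Around a vertex, the gap at a level where all its edges are removed excludes every other vertex,
    boundary ones included, and every edge not incident to it. *)
Lemma interior_near (B : set (gV G)) p : gvalid p -> interior_point B p ->
  exists (r : R) m, 0 < r /\ forall q, gvalid q -> gdist p q < r ->
    interior_point B q /\ (q = p \/ exists e t, (pickle e < m)%N /\ q = edgept e t).
Proof.
case: p => [v|e t] /= vp ip.
  have [m wm] := incident_bound G_locally_finite v.
  exists (sep G m), m; split; first exact: sep_gt0.
  move=> [u _ /(le_lt_trans (vdist_le_gdist _ _))|e t te].
    move=> /(vdist_lt_sep len_gt0 G_connected)/(tail_conn_isolated _ _ _ wm) -> /=.
    by split => //; left.
  move=> vt; split=> //; right; exists e, t; rewrite edgept_inside//; split=> //.
  apply: (wm e); move: vt => /(gdist_vertex_edge len_gt0 G_connected _ _ _ _ te)[[h _]|[h _]].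
    by left; exact: tail_conn_isolated wm (vdist_lt_sep len_gt0 G_connected _ _ _ h).
  by right; exact: tail_conn_isolated wm (vdist_lt_sep len_gt0 G_connected _ _ _ h).
exists (Num.min t (len e - t)), (pickle e).+1; split.
  by rewrite lt_min subr_gt0.
move=> q vq /(gdist_inside_edge len_gt0 G_connected _ _ _ vp vq)[s qE].
by rewrite qE in vq *; split => //; right; exists e, s; rewrite edgept_inside.
Qed.

Lemma closed_bdry (B : set (gV G)) : closed (bdry iota B).
Proof.
rewrite -[bdry iota B]setCK; apply: open_closedC; rewrite openE => x /contrapT.
move=> [p [vp ip <-]]; have [r [m [r0 near_p]]] := interior_near B p vp ip.
apply/nbhs_ballP; exists (r / 2); first by rewrite /= divr_gt0.
move=> y py; apply; have [|q vq qE] := iota_surj_near p r m r0 vp _ y py.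
  by move=> q vq /(near_p q vq)[].
exists q; split => //; apply: (near_p q vq _).1.
apply/(ball_iota iotaP) => //; rewrite qE; apply: le_ball py; lra.
Qed.

End Boundary.

Theorem theorem2p7 (R : realType) (G : mgraph R) (B : set (gV G))
  (Gbar : completePseudoMetricType R) (iota : gpoint G -> Gbar) :
  positive_lengths G -> locally_finite G -> connected_graph G ->
  (forall v, degree_one v -> B v) ->
  is_completion iota ->
  compact [set: Gbar] ->
  totally_disconnected (bdry iota B) ->
  (forall f : Gbar -> R, continuous f ->
     forall eps : R, 0 < eps ->
       exists2 phi, in_A iota phi & forall x, `|f x - phi x| < eps) /\
  (forall g : Gbar -> R, {within bdry iota B, continuous g} ->
     forall eps : R, 0 < eps ->
       exists2 phi, in_A iota phi &
         forall x, bdry iota B x -> `|g x - phi x| < eps).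
Proof.
move=> len_gt0 locfin conn _ iotaP cptG tdB.
have dense (f : Gbar -> R) : continuous f -> forall eps, 0 < eps ->
    exists2 phi, in_A iota phi & forall x, `|f x - phi x| < eps.
  by move=> cf eps; exact: dense_in_A tdB cf.
split=> // g cg eps eps0.
have clB := closed_bdry len_gt0 conn iotaP locfin B.
have [M [_ HM]] : bounded_set (g @` bdry iota B).
  apply: compact_bounded; apply: continuous_compact => //.
  exact: subclosed_compact clB cptG _.
have nG : normal_space Gbar by apply: compact_normal => //; have [] := iotaP.
(* The extension theorem wants a positive bound and [HM] one beyond [M], whose sign is unknown;
   hence [|M| + 1]. *)
have [||f [fg cf _]] := @continuous_bounded_extension Gbar R nG _ clB g (`|M| + 1) _ cg.
- by rewrite ltr_wpDl.
- by move=> x Bx; apply: HM; [rewrite ltr_pwDr// ler_norm|exists x].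
have [phi Aphi fphi] := dense f cf eps eps0.
by exists phi => // x Bx; rewrite fg ?inE.
Qed.
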